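(* Let $K = 1$, let $N \ge 1$ be arbitrary, let $H = \mathbf{h} = [h_1,\dots,h_N] \in \mathbb{C}^{1\times N}$ with $h_i \neq 0$ for all $i$, and let $p_1,\dots,p_N > 0$. Put $\theta_i = -\arg h_i$ for $i = 1,\dots,N$. Then $Q = \mathbf{w}\mathbf{w}^H$ with $\mathbf{w} = [\sqrt{p_1}\,e^{j\theta_1},\ \dots,\ \sqrt{p_N}\,e^{j\theta_N}]^T$ is an optimal solution of the problem of maximizing $\operatorname{tr}(HQH^H) = \mathbf{h} Q \mathbf{h}^H$ over Hermitian positive semidefinite $Q \in \mathbb{C}^{N\times N}$ subject to $q_{i,i} \le p_i$ for $i=1,\dots,N$.
   Context: $(\cdot)^H$ denotes the conjugate transpose, $(\cdot)^T$ the transpose, $q_{i,j}$ is the $(i,j)$ entry of $Q$, and in exponentials $j$ denotes the imaginary unit. $\arg z$ denotes an argument (phase) of the nonzero complex number $z$. *)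

(* Defs.v *)
From mathcomp Require Import all_boot all_order all_algebra.
From mathcomp Require Import sesquilinear spectral complex.
From mathcomp Require Import reals trigo.

Set Implicit Arguments.
Unset Strict Implicit.
Unset Printing Implicit Defensive.

Import Order.TTheory GRing.Theory Num.Theory.

Local Open Scope ring_scope.
Local Open Scope complex_scope.
Local Open Scope sesquilinear_scope.

(* e^{jt} *)
Definition expj (R : realType) (t : R) : R[i] := cos t +i* sin t.

(* Arguments are only determined modulo 2 pi, hence a relation. *)
Definition is_arg (R : realType) (z : R[i]) (t : R) : Prop :=
  z = `|z| * expj t.

(* On R[i], [x <= y] means that y - x is real and nonnegative, so [0 <= _] below
   includes the fact that the quadratic form is real. *)
Definition herm_psd (R : realType) (N : nat) (Q : 'M[R[i]]_N) : Prop :=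
  Q \is hermsymmx /\
  forall x : 'cV[R[i]]_N, 0 <= (x ^t* *m Q *m x) ord0 ord0.

Definition feasible (R : realType) (N : nat) (p : 'I_N -> R)
    (Q : 'M[R[i]]_N) : Prop :=
  herm_psd Q /\ forall i : 'I_N, Q i i <= (p i)%:C.

Definition objective (R : realType) (K N : nat) (H : 'M[R[i]]_(K, N))
    (Q : 'M[R[i]]_N) : R[i] :=
  \tr (H *m Q *m H ^t*).

(* The values of the objective at Hermitian matrices are real, so the order of
   R[i] compares them as real numbers. *)
Definition optimal (R : realType) (K N : nat) (H : 'M[R[i]]_(K, N))
    (p : 'I_N -> R) (Q : 'M[R[i]]_N) : Prop :=
  feasible p Q /\
  forall Q' : 'M[R[i]]_N, feasible p Q' -> objective H Q' <= objective H Q.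

(* Main.v *)
(** Let [q x := x^H Q x], [v := h^H = sum_i v_i e_i], [c_i := |h_i| sqrt (p_i)]
    and [S := sum_i c_i].  As a positive semidefinite form, [q] satisfies the
    weighted Jensen inequality [q v <= S * sum_i q (v_i e_i) / c_i]: sum over [i]
    the inequalities [0 <= q (S v_i e_i - c_i v) / c_i].  Since
    [q (v_i e_i) = |h_i|^2 Q_ii <= c_i^2], this gives [h Q h^H <= S^2], and
    [w w^H] attains the bound because [h w = S]. *)
Require Import Defs.
From mathcomp Require Import all_boot all_order all_algebra.
From mathcomp Require Import sesquilinear spectral complex.
From mathcomp Require Import reals trigo.
From mathcomp Require Import ring.

Set Implicit Arguments.
Unset Strict Implicit.
Unset Printing Implicit Defensive.

Import Order.TTheory GRing.Theory Num.Theory.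

Local Open Scope ring_scope.
Local Open Scope complex_scope.
Local Open Scope sesquilinear_scope.

Section HermitianForms.
Local Close Scope complex_scope.
Variable C : numClosedFieldType.

Lemma trmxC_mul m n k (A : 'M[C]_(m, n)) (B : 'M[C]_(n, k)) :
  (A *m B)^t* = B^t* *m A^t*.
Proof. by rewrite trmx_mul map_mxM. Qed.

Definition sform n (Q : 'M[C]_n) (x y : 'cV[C]_n) : C :=
  (x^t* *m Q *m y) ord0 ord0.

Lemma sformBr n (Q : 'M[C]_n) x a y b z :
  sform Q x (a *: y - b *: z) = a * sform Q x y - b * sform Q x z.
Proof. by rewrite /sform mulmxBr -!scalemxAr !mxE. Qed.

Lemma sformBl n (Q : 'M[C]_n) x y z a b :
  sform Q (a *: y - b *: z) x = a^* * sform Q y x - b^* * sform Q z x.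
Proof.
rewrite /sform; have -> : (a *: y - b *: z)^t* = a^* *: y^t* - b^* *: z^t*.
  by apply/matrixP => i j; rewrite !mxE rmorphB !rmorphM.
by rewrite !mulmxBl -!scalemxAl !mxE.
Qed.

Lemma sform_sumr n (Q : 'M[C]_n) x I (r : seq I) (P : pred I) u :
  sform Q x (\sum_(i <- r | P i) u i) = \sum_(i <- r | P i) sform Q x (u i).
Proof. by rewrite /sform mulmx_sumr summxE. Qed.

Lemma sform_suml n (Q : 'M[C]_n) x I (r : seq I) (P : pred I) u :
  sform Q (\sum_(i <- r | P i) u i) x = \sum_(i <- r | P i) sform Q (u i) x.
Proof. by rewrite /sform !raddf_sum /= !mulmx_suml summxE. Qed.

Lemma sform_delta n (Q : 'M[C]_n) i a :
  sform Q (a *: delta_mx i ord0) (a *: delta_mx i ord0) = a^* * a * Q i i.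
Proof.
have aE : (a *: delta_mx i ord0)^t* = a^* *: delta_mx ord0 i :> 'M_(1, n).
  by apply/matrixP => j k; rewrite !mxE rmorphM rmorph_nat andbC.
rewrite /sform aE.
by rewrite -scalemxAr -!scalemxAl -rowE -colE !mxE mulrA [a * _]mulrC.
Qed.

Lemma psd_form_le n (Q : 'M[C]_n) (v : 'cV[C]_n) (c : 'I_n -> C) :
    (0 < n)%N -> (forall x, 0 <= sform Q x x) -> (forall i, 0 < c i) ->
    (forall i, (v i ord0)^* * v i ord0 * Q i i <= c i ^+ 2) ->
  sform Q v v <= (\sum_i c i) ^+ 2.
Proof.
move=> n0 Qpsd c0 Qle; set S := \sum_i c i.
(* Strict positivity, which comes from [0 < n], lets a factor [S] be cancelled at the end. *)
have S0 : 0 < S.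
  rewrite /S (bigD1 (Ordinal n0)) //= ltr_pwDl //.
  by apply: sumr_ge0 => i _; apply: ltW.
pose u i := v i ord0 *: delta_mx i ord0 : 'cV[C]_n.
have vE : v = \sum_i u i.
  by rewrite [LHS]matrix_sum_delta; apply: eq_bigr => i _; rewrite big_ord1.
(* The expansion of [q (S u_i - c_i v) / c_i], with [q (u_i)] already replaced by its bound
   [c_i^2]. *)
have key i : 0 <= S ^+ 2 * c i - S * (sform Q (u i) v + sform Q v (u i))
                  + c i * sform Q v v.
  have := Qpsd (S *: u i - c i *: v).
  rewrite sformBr !sformBl !geC0_conj ?(ltW S0) ?(ltW (c0 i)) // sform_delta.
  (* Multiplying by [c i] clears the division; the two sides then differ by [S^2 (c_i^2 - q (u_i))],
     which is nonnegative. *)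
  move=> /le_trans ge0; rewrite -(pmulr_rge0 _ (c0 i)); apply: ge0.
  rewrite -subr_ge0.
  suff -> : forall A B D q a : C, a * (S ^+ 2 * a - S * (A + B) + a * D)
      - (S * (S * q - a * B) - a * (S * A - a * D)) = S ^+ 2 * (a ^+ 2 - q).
    by rewrite mulr_ge0 ?exprn_ge0 ?subr_ge0 // ltW.
  by move=> *; ring.
have: 0 <= \sum_i (S ^+ 2 * c i - S * (sform Q (u i) v + sform Q v (u i))
                  + c i * sform Q v v) by apply: sumr_ge0.
(* As the [u i] sum to [v], both cross sums become [q v], and the total is [S (S^2 - q v)]. *)
rewrite big_split sumrB -!mulr_sumr -mulr_suml big_split /=.
rewrite -sform_suml -sform_sumr -vE -/S.
suff -> : forall B, S ^+ 2 * S - S * (B + B) + S * B = S * (S ^+ 2 - B).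
  by rewrite pmulr_rge0 // subr_ge0.
by move=> *; ring.
Qed.

Lemma outer_hermsymmx n (w : 'cV[C]_n) : w *m w^t* \is hermsymmx.
Proof.
by apply/is_hermitianmxP; rewrite expr0 scale1r trmxC_mul trmxCK.
Qed.

(** Serves twice: [A = x^H] shows that [w w^H] is semidefinite, [A = h] computes its objective
    value. *)
Lemma outer_form m (n : nat) (A : 'M[C]_(m, n)) (w : 'cV[C]_n) :
  A *m (w *m w^t*) *m A^t* = (A *m w) *m (A *m w)^t*.
Proof. by rewrite trmxC_mul !mulmxA. Qed.

Lemma mulmx_trmxC11 (A : 'M[C]_1) :
  (A *m A^t*) ord0 ord0 = `|A ord0 ord0| ^+ 2.
Proof. by rewrite mxE big_ord1 !mxE normCK. Qed.

End HermitianForms.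

Lemma expj_norm (R : realType) (t : R) : `|expj t| = 1.
Proof. by rewrite normc_def /= cos2Dsin2 sqrtr1. Qed.

Lemma expjN (R : realType) (t : R) : expj t * expj (- t) = 1.
Proof.
rewrite /expj cosN sinN; apply/eqP; rewrite eq_complex /=.
by rewrite mulrN opprK -!expr2 cos2Dsin2 eqxx mulrN mulrC addNr eqxx.
Qed.

Theorem mainTheorem4 (R : realType) (N : nat) (hN : (1 <= N)%N)
    (h : 'M[R[i]]_(1, N)) (hh : forall i : 'I_N, h ord0 i != 0)
    (p : 'I_N -> R) (hp : forall i : 'I_N, 0 < p i)
    (argh : 'I_N -> R) (hargh : forall i : 'I_N, is_arg (h ord0 i) (argh i)) :
  let theta : 'I_N -> R := fun i => - argh i in
  let w : 'cV[R[i]]_N := \col_i ((Num.sqrt (p i))%:C * expj (theta i)) in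
  optimal h p (w *m w ^t*).
Proof.
move=> theta w.
have sp i : 0 < (Num.sqrt (p i))%:C by rewrite ltcR sqrtr_gt0.
have wn i : `|w i ord0| = (Num.sqrt (p i))%:C.
  by rewrite mxE normrM expj_norm mulr1 gtr0_norm.
have sp2 i : (Num.sqrt (p i))%:C ^+ 2 = (p i)%:C.
  by rewrite -rmorphXn /= sqr_sqrtr // ltW.
pose c i := `|h ord0 i| * (Num.sqrt (p i))%:C.
have c0 i : 0 < c i by rewrite mulr_gt0 ?normr_gt0.
have hw : (h *m w) ord0 ord0 = \sum_i c i.
  (* The phase of [w_i] cancels that of [h_i], so all terms of [h w] add up coherently. *)
  rewrite mxE; apply: eq_bigr => i _; rewrite mxE {1}(hargh i).
  by rewrite mulrACA expjN mulr1.
split.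
  split; first split; first exact: outer_hermsymmx.
    move=> x; have := outer_form (x^t*) w; rewrite trmxCK => ->.
    by rewrite mulmx_trmxC11 exprn_ge0.
  (* Each diagonal entry is [|w_i|^2 = p_i]: every constraint is tight. *)
  by move=> i; rewrite mxE big_ord1 [_^t* _ _]mxE [_^T _ _]mxE -normCK wn sp2.
move=> Q [[_ Qpsd] Qle].
rewrite /objective outer_form /mxtrace !big_ord1 mulmx_trmxC11 hw.
rewrite (ger0_norm (sumr_ge0 _ (fun i _ => ltW (c0 i)))).
(* For [v = h^H], the diagonal hypothesis reads [|h_i|^2 Q_ii <= |h_i|^2 p_i], which is feasibility
   scaled by [|h_i|^2 > 0]. *)
have := @psd_form_le _ _ Q (h^t*) c hN Qpsd c0.
rewrite /sform trmxCK; apply=> i.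
rewrite !mxE conjCK -normCK exprMn sp2.
by rewrite ler_pM2l ?exprn_gt0 ?normr_gt0.
Qed.
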